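(* Let $(G,+)$ be a group (not necessarily abelian) with identity $0_G$, let $R$ be a reflexive relation on $G$, and let $A,B$ be nonempty subsets of $G$. Assume that $R$ is antisymmetric and isotone and satisfies properties (P4) and (P5) (relative to $B$), and that $A$ is finite. If $A$ is stable and $B=\{b\}$ is a singleton, then the following are equivalent: (i) $\mathscr{E}(A+B)=\mathscr{E}(A)$; (ii) $A+B=A$; (iii) $b=0_G$.
   Context: For $x,y\in G$, $xPy$ means that $xRy$ holds and $yRx$ does not. $R$ is antisymmetric if $xRy$ and $yRx$ imply $x=y$. $R$ is isotone if for all $g,g',z\in G$, $gRg'$ implies $(z+g)R(z+g')$ and $(g+z)R(g'+z)$. For an integer $p\geq 1$ and $g\in G$, $pg$ is the sum of $p$ copies of $g$. Property (P4): for every $m\geq 1$, all integers $p_1,\dots,p_m\geq 1$ and all $b^1,\dots,b^m\in B$, $(p_1b^1+\dots+p_mb^m)R0_G$ implies that at least one $b^l$ satisfies $b^lR0_G$. Property (P5): for every $m\geq 1$, all integers $p_1,\dots,p_m\geq 1$ and all $b^1,\dots,b^m\in B$, $0_GR(p_1b^1+\dots+p_mb^m)$ implies that at least one $b^l$ satisfies $0_GRb^l$. The sum set is $A+B=\{a+b: a\in A, b\in B\}$. For $S\subseteq G$, $\mathscr{E}(S)$ is the set of efficient points of $S$, i.e. of those $g\in S$ for which there is no $g'\in S$ with $g'Pg$; by convention $\mathscr{E}(\emptyset)=\emptyset$. A set $S$ is stable if $\mathscr{E}(S)=S$. *)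

(* Defs.v *)
(* A not necessarily abelian group is a [groupType], whose law is written
   multiplicatively: x * y for x + y, 1 for 0_G, x ^+ p for p x. *)
From mathcomp Require Import all_boot.
From mathcomp Require Import classical_sets.
From Corelib Require Relation_Definitions.

Set Implicit Arguments.
Unset Strict Implicit.
Unset Printing Implicit Defensive.

Local Open Scope classical_set_scope.
Local Open Scope group_scope.

(* [reflexive] and [antisymmetric] of ssrbool are about boolean relations. *)
Notation reflexiveP R := (Relation_Definitions.reflexive _ R).
Notation antisymmetricP R := (Relation_Definitions.antisymmetric _ R).

Definition strict_part (T : Type) (R : T -> T -> Prop) (x y : T) : Prop :=
  R x y /\ ~ R y x.

Definition efficient (T : Type) (R : T -> T -> Prop) (S : set T) : set T :=
  [set g | S g /\ ~ exists2 g', S g' & strict_part R g' g].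

Definition stable (T : Type) (R : T -> T -> Prop) (S : set T) : Prop :=
  efficient R S = S.

Definition isotone (G : groupType) (R : G -> G -> Prop) : Prop :=
  forall g g' z : G, R g g' -> R (z * g) (z * g') /\ R (g * z) (g' * z).

Definition sumset (G : groupType) (A B : set G) : set G :=
  [set a * b | a in A & b in B].

(* The products below are taken in increasing order of the index. *)
Definition propP4 (G : groupType) (R : G -> G -> Prop) (B : set G) : Prop :=
  forall (m : nat) (p : 'I_m -> nat) (b : 'I_m -> G),
    (0 < m)%N -> (forall l, (0 < p l)%N) -> (forall l, B (b l)) ->
    R (\prod_(l < m) b l ^+ p l) 1 -> exists l, R (b l) 1.

Definition propP5 (G : groupType) (R : G -> G -> Prop) (B : set G) : Prop :=
  forall (m : nat) (p : 'I_m -> nat) (b : 'I_m -> G),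
    (0 < m)%N -> (forall l, (0 < p l)%N) -> (forall l, B (b l)) ->
    R 1 (\prod_(l < m) b l ^+ p l) -> exists l, R 1 (b l).

(* Main.v *)
Require Import Defs.
From mathcomp Require Import all_boot.
From mathcomp Require Import boolp classical_sets cardinality.

(** Write the law multiplicatively, so that A + B becomes the translate A b.
    Right translation by b is an automorphism of the relation R, its inverse
    being translation by b^-1; hence a translate of a stable set is stable
    ([stable_sumset1]), and the equality of the efficient sets of A b and A is
    just A b = A.

    If A b = A, then A contains the whole forward orbit a, a b, a b^2, ... of
    any of its points; A being finite, two points of the orbit coincide and b
    has finite order ([finite_invariant_torsion]).  In a torsion situation
    b^n = 1, reflexivity gives both b^n R 1 and 1 R b^n.  (P4) and (P5), for
    sums with a single term, turn these into b R 1 and 1 R b, so that b = 1 by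
    antisymmetry ([torsion_trivial]). *)

Local Open Scope classical_set_scope.
Local Open Scope group_scope.

Lemma sumset_set1r (G : groupType) (A : set G) (b : G) :
  sumset A [set b] = [set a * b | a in A].
Proof.
apply/seteqP; split=> x; first by case=> a Aa [_ -> <-]; exists a.
by case=> a Aa <-; exists a => //; exists b.
Qed.

Lemma isotone_mul2r (G : groupType) (R : G -> G -> Prop) (z x y : G) :
  isotone R -> R (x * z) (y * z) <-> R x y.
Proof.
move=> Riso; split=> [Rxyz | /(Riso _ _ z)[] //].
by have [_] := Riso _ _ z^-1 Rxyz; rewrite !mulgK.
Qed.

(** A point dominating a b in A b is some a' b, and cancelling b makes a'
    dominate a in A. *)
Lemma stable_sumset1 (G : groupType) (R : G -> G -> Prop) (A : set G) (b : G) :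
  isotone R -> stable R A -> stable R (sumset A [set b]).
Proof.
move=> Riso Astable; rewrite /stable sumset_set1r.
apply/seteqP; split=> [x [] // | _ [a Aa <-]]; split; first by exists a.
move=> [_ [a' Aa' <-] [Ra'a nRaa']].
have [_ []] : efficient R A a by rewrite Astable.
exists a' => //; split; first exact/(isotone_mul2r _ _ b _ _ Riso).
by move=> Raa'; apply/nRaa'/(isotone_mul2r _ _ b _ _ Riso).
Qed.

(** Pigeonhole on the forward orbit of a point of A. *)
Lemma finite_invariant_torsion (G : groupType) (A : set G) (b : G) :
  finite_set A -> A !=set0 -> sumset A [set b] `<=` A ->
  exists2 n, (0 < n)%N & b ^+ n = 1.
Proof.
rewrite sumset_set1r => Afin [a Aa] AbA.
have orbitA n : A (a * b ^+ n).
  elim: n => [|n IHn]; first by rewrite expg0 mulg1.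
  by rewrite expgSr mulgA; apply: AbA; exists (a * b ^+ n).
apply: contrapT => free; apply: infinite_nat.
have -> : [set: nat] = (fun n => a * b ^+ n) @^-1` A.
  by apply/seteqP; split=> n _ //; apply: orbitA.
have orbit_lt i j : (i < j)%N -> a * b ^+ i <> a * b ^+ j.
  move=> ltij /mulgI eqij; apply: free; exists (j - i)%N; first by rewrite subn_gt0.
  by apply: (mulgI (b ^+ i)); rewrite -expgnDr subnKC 1?ltnW // mulg1 eqij.
apply: finite_preimage Afin => i j _ _ eqij.
case: (ltngtP i j) => // [/orbit_lt | /orbit_lt/nesym] //.
Qed.

Lemma torsion_trivial (G : groupType) (R : G -> G -> Prop) (B : set G)
    (b : G) (n : nat) :
  reflexiveP R -> antisymmetricP R -> propP4 R B -> propP5 R B ->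
  B b -> (0 < n)%N -> b ^+ n = 1 -> b = 1.
Proof.
move=> Rrefl Ranti RP4 RP5 Bb n0 bn1; apply: Ranti.
  have [] // := RP4 1%N (fun=> n) (fun=> b).
  by rewrite big_ord1 bn1; apply: Rrefl.
have [] // := RP5 1%N (fun=> n) (fun=> b).
by rewrite big_ord1 bn1; apply: Rrefl.
Qed.

Theorem theorem5 (G : groupType) (R : G -> G -> Prop) (A B : set G)
    (Rrefl : reflexiveP R) (A0 : A !=set0) (B0 : B !=set0)
    (Ranti : antisymmetricP R) (Riso : isotone R)
    (RP4 : propP4 R B) (RP5 : propP5 R B) (Afin : finite_set A)
    (Astable : stable R A) (b : G) (Bb : B = [set b]) :
  [<-> efficient R (sumset A B) = efficient R A;
       sumset A B = A;
       b = 1].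
Proof.
tfae.
- by rewrite Astable Bb (stable_sumset1 _ _ _ b Riso Astable).
- rewrite {1}Bb => AbA.
  have [|n n0 bn1] := @finite_invariant_torsion _ A b Afin A0.
    by rewrite AbA.
  by apply: (torsion_trivial _ _ _ _ _ Rrefl Ranti RP4 RP5 _ n0 bn1); rewrite Bb.
- move=> b1; congr (efficient R _); rewrite Bb b1 sumset_set1r.
  by rewrite (eq_imagel (f' := id)) ?image_id // => x _; rewrite mulg1.
Qed.
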